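(* Let $G$ be a finite non-Abelian solvable group with derived series $$\{1\}=G^{(l)} \triangleleft G^{(l-1)} \triangleleft \cdots \triangleleft G''\triangleleft G' \triangleleft G,$$ where $l$ is the derived length of $G$. Then for every integer $n\ge 1$, $$D(G^n) \le n^{l}\, |G| \prod_{i=0}^{l-2}\left( |G^{(i)}| +1\right).$$
   Context: $G^{(0)}=G$ and $G^{(i+1)}=(G^{(i)})'$ is the commutator subgroup of $G^{(i)}$; $l$ is the least integer with $G^{(l)}=\{1\}$. For a finite group $G$ with generating set $A$ and $g\in G$, $l_A(g)$ is the length of a shortest word in the elements of $A$ (no inverses allowed) representing $g$; the identity is represented by the empty word, of length $0$. The diameter is $\operatorname{diam}(G,A)=\max\{l_A(g): g\in G\}$, and $D(G)$ is the maximum of $\operatorname{diam}(G,A)$ over all generating sets $A$ of $G$. $G^n$ is the $n$-th direct power of $G$. *)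

(* Defs.v *)
From mathcomp Require Import all_boot all_fingroup all_solvable.
Set Implicit Arguments.
Unset Strict Implicit.
Unset Printing Implicit Defensive.
Import GroupScope.

Section Diameter.

Variable gT : finGroupType.
Implicit Types (A G : {set gT}) (g : gT) (k : nat).

Definition word_of_size A g k : bool :=
  [exists w : k.-tuple gT, all [in A] w && (\prod_(x <- w) x == g)].

(* In a finite group, the submonoid generated by A is the subgroup <<A>>. *)
Lemma word_of_size_ex A g : g \in <<A>> -> exists k, word_of_size A g k.
Proof.
case/gen_prodgP=> k [c Ac ->]; exists k; apply/existsP.
exists (map_tuple c (ord_tuple k)); rewrite big_map big_tuple.
rewrite (eq_bigr c) => [|i _]; last by rewrite tnth_ord_tuple.
rewrite eqxx andbT.
by apply/allP=> _ /mapP[i _ ->]; apply: Ac.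
Qed.

(* The value 0 for g \notin <<A>> is a dummy, never used when <<A>> = G. *)
Definition word_length A g : nat :=
  if @idP (g \in <<A>>) is ReflectT Ag then ex_minn (word_of_size_ex Ag) else 0.

Lemma word_lengthP A g : g \in <<A>> ->
  word_of_size A g (word_length A g) /\
  (forall k, word_of_size A g k -> word_length A g <= k).
Proof.
by move=> Ag; rewrite /word_length; case: {-}_ / idP => // Ag'; case: ex_minnP.
Qed.

Definition diam G A : nat := \max_(g in G) word_length A g.

Definition max_diam G : nat := \max_(A : {set gT} | <<A>> == G) diam G A.

End Diameter.

Definition direct_power (gT : finGroupType) (G : {group gT}) (n : nat) :
    {group {dffun 'I_n -> gT}} :=
  [group of setXn (fun _ : 'I_n => G)].

(* Main.v *)
(** Let [B] be a generating set together with [1]. If [N] is normal in [G] and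
    every coset of [N] meets [B^d], then the elements of [N] of length at most
    [2d + 1] generate [N] (Schreier's argument, with short representatives of
    inverse cosets in place of inverses); hence
    [D(G) <= d + (2d + 1) * D(N)].  For the abelian factors [(H / H')^n], with
    [m = #|H / H'|], a chain of subgroups obtained by adding generators one at a
    time, with successive indices [x <= m], gives [d <= n * (m - 1)], because
    [m ^ (x - 1) <= x ^ (m - 1)].  Iterating down the derived series gives the
    bound. *)
Require Import Defs.
From mathcomp Require Import all_boot all_fingroup all_solvable.
From mathcomp Require Import zify ring.
Import GroupScope.

(** * An inequality between powers *)

Lemma expS_leq_mulS (m k : nat) : k <= m -> (m.+1 ^ k <= k.+1 * m ^ k)%N.
Proof.
elim: k => [|k IHk] ltkm //.
have IH := IHk (ltnW ltkm); rewrite !expnS; set p := (m ^ k)%N in IH *.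
have: (m.+1 * m.+1 ^ k <= m.+1 * (k.+1 * p))%N by rewrite leq_mul2l IH orbT.
(* After cancelling [p], what remains is [(m + 1)(k + 1) <= (k + 2) m], that is, [k + 1 <= m]. *)
by move/leq_trans; apply; rewrite !mulnA leq_mul2r; apply/orP; right; nia.
Qed.

(** Induction on [m - x] from equality at [m = x]: raising [m] by one multiplies the right side by
    [x] and the left side by at most [x]. *)
Lemma expn_pred_leq (m x : nat) :
  0 < x -> x <= m -> (m ^ x.-1 <= x ^ m.-1)%N.
Proof.
case: x => // x _ /subnKC <-; move: (m - _)%N => {m} d; elim: d => [|d IHd].
  by rewrite addn0.
rewrite addnS addSn /= in IHd *.
apply: leq_trans (expS_leq_mulS _ _ _) _; first by lia.
by rewrite [(x.+1 ^ _)%N]expnS leq_mul2l IHd orbT.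
Qed.

(** * Covering a group by products of bounded length *)

Section Reach.

Variable gT : finGroupType.
Implicit Types (A B : {set gT}) (G H N : {group gT}).

Lemma mem1_expgs A n : 1 \in A -> 1 \in A ^+ n.
Proof.
by move=> A1; elim: n => [|n IHn]; rewrite ?set11 // expgS -[1]mulg1 mem_mulg.
Qed.

Lemma expgs_subG A G n : A \subset G -> A ^+ n \subset G.
Proof.
by move=> sAG; elim: n => [|n IHn]; rewrite ?sub1G // expgS mul_subG.
Qed.

Lemma expgs_subset A B n : A \subset B -> A ^+ n \subset B ^+ n.
Proof. by move=> sAB; elim: n => // n IHn; rewrite !expgS mulgSS. Qed.

Lemma expgs_leq A m n : 1 \in A -> m <= n -> A ^+ m \subset A ^+ n.
Proof.
move=> A1 /subnKC <-; rewrite expgnDr.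
by apply: mulg_subl; apply: mem1_expgs.
Qed.

(** Adjoining [1] pads words to length exactly [k]; deleting these letters gives back a word over
    [A]. *)
Lemma expgs_word A g k :
  g \in (1 |: A) ^+ k -> exists2 j, j <= k & word_of_size A g j.
Proof.
elim: k g => [|k IHk] g.
  rewrite expg0 => /set1P->; exists 0 => //.
  by apply/existsP; exists [tuple]; rewrite big_nil /= eqxx.
rewrite expgS => /mulsgP[a h /setU1P[-> | Aa] /IHk[j lejk jh] ->].
  by exists j; rewrite ?mul1g // ltnW.
exists j.+1 => //; case/existsP: jh => w /andP[Aw /eqP hE].
by apply/existsP; exists [tuple of a :: w]; rewrite big_cons hE eqxx /= Aa Aw.
Qed.

Lemma diam_leq A G k : <<A>> = G -> G \subset (1 |: A) ^+ k -> diam G A <= k.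
Proof.
move=> genA sGk; apply/bigmax_leqP=> g Gg.
have [j lejk jg] := expgs_word _ _ _ (subsetP sGk g Gg).
have Ag : g \in <<A>> by rewrite genA.
by apply: leq_trans lejk; apply: (word_lengthP Ag).2.
Qed.

Lemma cycle_cosets a H g :
    a \in 'N(H) -> g \in <[a]> <*> H ->
  exists2 i, i < #[coset H a] & a ^- i * g \in H.
Proof.
move=> nHa; have nH_a : <[a]> \subset 'N(H) by rewrite cycle_subG.
rewrite norm_joinEl // => /mulsgP[_ h /cycleP[j ->] Hh ->{g}].
have: coset H (a ^+ j) \in <[coset H a]>.
  by rewrite -quotient_cycle // mem_quotient // mem_cycle.
case/cyclePmin=> i lti Ei; exists i => //.
rewrite mulgA groupMr //.
have Nj k : a ^+ k \in 'N(H) by rewrite groupX.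
rewrite coset_idr ?groupM ?groupV // morphM ?groupV // morphV //=.
by rewrite Ei morphX //= mulVg.
Qed.

(** The second conclusion is [k <= (m - 1) log_m #|<<A>>|] without logarithms; in this form it is
    multiplicative along a chain of subgroups. *)
Lemma abelian_gen_reach A m :
    0 < m -> abelian <<A>> -> exponent <<A>> %| m ->
  exists2 k, <<A>> \subset (1 |: A) ^+ k & (m ^ k <= #|<<A>>| ^ m.-1)%N.
Proof.
move=> m0; have [n leAn] := ubnP #|A|; elim: n => // n IHn in A leAn *.
have [-> _ _ | [a Aa]] := set_0Vmem A.
  by exists 0; rewrite ?gen0 ?cards1 ?exp1n.
move=> abA expA; pose A1 := A :\ a.
have sA1A : A1 \subset A by apply: subD1set.
have sA1gen : <<A1>> \subset <<A>> by apply: genS.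
have expA1 := dvdn_trans (exponentS sA1gen) expA.
have [|k sk lek] := IHn A1 _ (abelianS sA1gen abA) expA1.
  by move: leAn; rewrite (cardsD1 a A) Aa.
have genE : <<A>> = <[a]> <*> <<A1>>.
  by rewrite joing_idl joing_idr -{1}(setD1K Aa).
have aA : a \in <<A>> by apply: mem_gen.
have nA1 : <<A>> \subset 'N(<<A1>>).
  by apply: sub_abelian_norm.
have na : a \in 'N(<<A1>>) := subsetP nA1 a aA.
set x := #[coset <<A1>>%G a].
have x0 : 0 < x by apply: order_gt0.
have lexm : x <= m.
  apply: dvdn_leq => //; apply: dvdn_trans expA.
  apply: dvdn_trans (dvdn_exponent aA).
  by apply: morph_order.
have cardE : #|<<A>>| = (#|<<A1>>| * x)%N.
  rewrite -(Lagrange sA1gen) -card_quotient //; congr (_ * _)%N.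
  by rewrite /= genE quotientYidr ?cycle_subG // quotient_cycle.
(* The new generator [a] costs at most [x - 1] letters and multiplies the order by [x]. *)
exists (x.-1 + k)%N; last first.
  rewrite cardE expnMn expnD mulnC leq_mul //; exact: expn_pred_leq.
apply/subsetP=> g; rewrite genE => /cycle_cosets-/(_ na)[i lti Hi].
rewrite expgnDr -[g](mulKVg (a ^+ i)) mem_mulg //.
  have: a ^+ i \in (1 |: A) ^+ i.
    by elim: (i) => [|j IHj]; rewrite ?set11 // !expgS mem_mulg ?setU1r.
  by apply/subsetP; apply: expgs_leq; rewrite ?setU11 // -ltnS prednK.
by move: Hi => /(subsetP sk); apply/subsetP/expgs_subset/setUS.
Qed.

Lemma abelian_reach A G m n :
    0 < m -> <<A>> = G -> abelian G -> exponent G %| m -> #|G| = (m ^ n)%N ->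
  G \subset (1 |: A) ^+ (n * m.-1).
Proof.
move=> m0 genA abG expG cardG.
(* Exponents can be compared only for a base above [1]; for [m = 1] the group is trivial. *)
have [m1 | m_gt1] := leqP m 1.
  have G1 : #|G| <= 1.
    by rewrite cardG; move: m0 m1; case: (m) => [|[|]] //; rewrite exp1n.
  by rewrite (card_le1_trivg G1) sub1set mem1_expgs ?setU11.
rewrite -genA in abG expG cardG *; clear G genA.
have [k sk lek] := abelian_gen_reach _ _ m0 abG expG.
apply: subset_trans sk (expgs_leq _ _ _ _ _); first exact: setU11.
by move: lek; rewrite cardG -expnM leq_exp2l.
Qed.

(** A word over the image of [A] lifts letter by letter to a word over [A] in the same coset. *)
Lemma quotient_reach A G N k :
    <<A>> = G -> N <| G -> G / N \subset (1 |: A / N) ^+ k ->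
  G \subset (1 |: A) ^+ k * N.
Proof.
move=> genA /andP[_ nNG] sk.
have lift j q : q \in (1 |: A / N) ^+ j ->
    exists2 b, b \in (1 |: A) ^+ j & b \in 'N(N) /\ coset N b = q.
  elim: j q => [|j IHj] q.
    by rewrite expg0 => /set1P->; exists 1; rewrite ?set11 ?group1 ?morph1.
  rewrite expgS => /mulsgP[r s Br /IHj[b Bb [Nb <-]] ->{q s}].
  have [a Ba [Na <-]] : exists2 a, a \in 1 |: A & a \in 'N(N) /\ coset N a = r.
    case/setU1P: Br => [->|/morphimP[a Na Aa ->]].
      by exists 1; rewrite ?setU11 ?group1 ?morph1.
    by exists a; rewrite ?setU1r.
  by exists (a * b); rewrite ?expgS ?mem_mulg ?groupM ?morphM.
apply/subsetP=> g Gg; have Ng := subsetP nNG g Gg.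
have [b Bb [Nb Eb]] := lift _ _ (subsetP sk _ (mem_quotient N Gg)).
rewrite -[g](mulKVg b) mem_mulg // coset_idr ?groupM ?groupV //.
by rewrite morphM ?groupV // morphV //= Eb mulVg.
Qed.

Lemma Schreier_short_gen A G N d :
    <<A>> = G -> N <| G -> G \subset (1 |: A) ^+ d * N ->
  <<(1 |: A) ^+ d.*2.+1 :&: N>> = N.
Proof.
move=> genA nsNG sGd; have [sNG nNG] := andP nsNG.
set B := 1 |: A; set S := B ^+ _ :&: N; pose T := B ^+ d.
have B1 : 1 \in B by apply: setU11.
have sBG : B \subset G by rewrite subUset sub1set group1 -genA subset_gen.
have T1 : 1 \in T by apply: mem1_expgs.
have sTG : T \subset G by apply: expgs_subG.
have sHN : <<S>> \subset N by rewrite gen_subG subsetIr.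
(* Here [u] represents the coset of [a * t] and [t'] that of its inverse. Both [t' * (a * t)] and
   [t' * u] lie in [N], with lengths at most [2d + 1] and [2d], and [a * t] is [u] times a quotient
   of the two. *)
have closed a h : a \in B -> h \in T * <<S>> -> a * h \in T * <<S>>.
  move=> Ba /mulsgP[t {}h Tt Sh ->].
  have Gat : a * t \in G.
    by rewrite groupM ?(subsetP sBG a Ba) ?(subsetP sTG t Tt).
  have /mulsgP[u n Tu Nn atE] := subsetP sGd _ Gat.
  have /mulsgP[t' n' Tt' Nn' atVE] := subsetP sGd _ (groupVr Gat).
  have Gu : u \in G := subsetP sTG u Tu.
  have t'E : t' = (a * t)^-1 * n'^-1 by rewrite atVE mulgK.
  have St'at : t' * (a * t) \in S.
    rewrite inE {2}t'E -mulgA -conjgE.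
    rewrite memJ_norm ?groupV ?(subsetP nNG) // Nn' andbT.
    by rewrite -addnn -addnS expgnDr mem_mulg // expgS mem_mulg.
  have St'u : t' * u \in S.
    rewrite inE {2}t'E atE invMg -!mulgA groupMl ?groupV //.
    rewrite -conjgE memJ_norm ?groupV ?(subsetP nNG) // Nn' andbT.
    by rewrite -addnn -addnS expgnDr mem_mulg // expgSr -[u]mulg1 mem_mulg.
  have ->: a * (t * h) = u * ((t' * u)^-1 * (t' * (a * t)) * h).
    by rewrite invMg !mulgA mulgV mul1g mulVg mul1g.
  by rewrite mem_mulg // groupM // groupM ?groupV //; apply: mem_gen.
apply/eqP; rewrite eqEsubset sHN; apply/subsetP=> x Nx.
have /mulsgP[t h Tt Sh xE] : x \in T * <<S>>.
  have [k Ek] := gen_expgs A.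
  have: x \in B ^+ k by rewrite -Ek genA (subsetP sNG).
  elim: k x {Nx Ek} => [|k IHk] x.
    by rewrite expg0 => /set1P->; rewrite -[1]mulg1 mem_mulg.
  by rewrite expgS => /mulsgP[a y Ba /IHk ? ->]; apply: closed.
(* Since [x] and [h] lie in [N], so does [t]; its length is at most [d], so it is itself in [S]. *)
rewrite xE groupMr // mem_gen // inE; apply/andP; split.
  by apply: subsetP Tt; apply: expgs_leq => //; lia.
by move: Nx; rewrite xE groupMr // (subsetP sHN).
Qed.

(** After [d] letters an element of [N] remains; it is a product of [e] short Schreier generators,
    each costing at most [2d + 1] letters. *)
Lemma normal_reach A G N d e :
    <<A>> = G -> N <| G -> G \subset (1 |: A) ^+ d * N ->
    (forall C, <<C>> = N -> N \subset (1 |: C) ^+ e) ->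
  G \subset (1 |: A) ^+ (d + d.*2.+1 * e).
Proof.
move=> genA nsNG sGd reachN.
apply: (subset_trans sGd); rewrite expgnDr expgM mulgS //.
apply: subset_trans (reachN _ (Schreier_short_gen _ _ _ _ genA nsNG sGd)) _.
by rewrite expgs_subset // subUset sub1set mem1_expgs ?setU11 // subsetIl.
Qed.

End Reach.

(** * Direct powers along the derived series *)

Section DirectPower.

Variable gT : finGroupType.
Implicit Types (G : {group gT}).

Lemma der_der1 G i : G^`(1)^`(i) = G^`(i.+1).
Proof. by elim: i => //= i IHi; rewrite dergSn IHi. Qed.

Lemma card_direct_power G n : #|direct_power G n| = (#|G| ^ n)%N.
Proof. by rewrite cardsXn prod_nat_const card_ord. Qed.

Lemma direct_power_der_normal G n :
  direct_power G^`(1) n <| direct_power G n.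
Proof.
apply/andP; split; first by apply: setXnS => i; apply: der_sub.
apply/subsetP=> x /setXnP Gx; rewrite inE.
apply/subsetP=> _ /imsetP[y /setXnP G'y ->].
apply/setXnP=> i; rewrite !ffunE.
have nx : x i \in 'N(G^`(1)) by rewrite (subsetP (der_norm 1 G)) ?Gx.
by have := G'y i; rewrite -(memJ_norm _ nx).
Qed.

Lemma direct_power_der_abelian G n :
  abelian (direct_power G n / direct_power G^`(1) n).
Proof.
apply: sub_der1_abelian; rewrite gen_subG; apply/subsetP.
move=> _ /imset2P[x y /setXnP Gx /setXnP Gy ->].
apply/setXnP=> i; rewrite !ffunE.
exact: mem_commg.
Qed.

Lemma exponent_quotient_direct_power G n :
  exponent (direct_power G n / direct_power G^`(1) n) %| #|G : G^`(1)|.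
Proof.
apply/exponentP=> _ /morphimP[x Nx /setXnP Gx ->].
rewrite -morphX //; apply: coset_id; apply/setXnP=> i.
have ->: (x ^+ #|G : G^`(1)|) i = x i ^+ #|G : G^`(1)|.
  by elim: #|_ : _| => [|k IHk]; rewrite ?expgS ffunE ?IHk.
have nGi : x i \in 'N(G^`(1)) := subsetP (der_norm 1 G) _ (Gx i).
apply: coset_idr; first exact: groupX.
rewrite morphX //= -card_quotient ?der_norm //.
by apply/eqP; rewrite -order_dvdn order_dvdG // mem_quotient.
Qed.

Lemma direct_power_der_step G n e (A : {set {dffun 'I_n -> gT}}) :
    <<A>> = direct_power G n ->
    (forall C : {set {dffun 'I_n -> gT}}, <<C>> = direct_power G^`(1) n ->
       direct_power G^`(1) n \subset (1 |: C) ^+ e) ->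
  direct_power G n \subset
    (1 |: A) ^+ (n * #|G : G^`(1)|.-1 + (n * #|G : G^`(1)|.-1).*2.+1 * e).
Proof.
move=> genA reachN; have nsN := direct_power_der_normal G n.
apply: (normal_reach _ _ _ _ _ _ genA nsN) => //.
apply: quotient_reach => //.
apply: abelian_reach => //.
- rewrite -quotient_gen ?genA //.
  by rewrite (subset_trans _ (normal_norm nsN)) // -genA subset_gen.
- exact: direct_power_der_abelian.
- exact: exponent_quotient_direct_power.
rewrite card_quotient ?normal_norm // -divgS ?normal_sub //.
rewrite !card_direct_power -(Lagrange (der_sub 1 G)) expnMn mulKn //.
by rewrite expn_gt0 cardG_gt0.
Qed.

(** Applied with [m = #|G : G'|] and [g = #|G|]. With [d = n (m - 1)], the left side is at most
    [(3d + 1) b], and [n m (m + 1) - 3d = n ((m - 1)^2 + 2)] is at least [1]. *)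
Lemma der_bound_step n m g b :
    0 < n -> 0 < m -> m <= g -> 0 < b ->
  (n * m.-1 + (n * m.-1).*2.+1 * b <= n * m * (g + 1) * b)%N.
Proof.
case: m => // m n0 _ lemg b0 /=; set d := (n * m)%N.
have le1 : (d + d.*2.+1 * b <= (3 * d + 1) * b)%N by nia.
apply: leq_trans le1 _; rewrite leq_mul2r; apply/orP; right.
apply: (@leq_trans (n * m.+1 * (m.+1 + 1))%N).
  by rewrite /d; nia.
by rewrite leq_mul2l leq_add2r lemg orbT.
Qed.

Lemma direct_power_reach G l n (A : {set {dffun 'I_n -> gT}}) :
    0 < n -> G^`(l.+1) = 1 -> <<A>> = direct_power G n ->
  direct_power G n \subset
    (1 |: A) ^+ (n ^ l.+1 * #|G| * \prod_(0 <= i < l) (#|G^`(i)| + 1)).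
Proof.
move=> n0; elim: l G A => [|l IHl] G A Gl genA.
  (* In the base case [G] is abelian, so the subgroup is reached with [e = 0] and only the abelian
     estimate remains. *)
  have der_triv C :
      <<C>> = direct_power G^`(1) n ->
    direct_power G^`(1) n \subset (1 |: C) ^+ 0.
    by rewrite subG1 trivg_card1 card_direct_power /= Gl cards1 exp1n.
  apply: subset_trans (direct_power_der_step _ _ _ _ genA der_triv) _.
  rewrite muln0 addn0 big_nil muln1 expn1 expgs_leq ?setU11 //.
  by rewrite leq_mul2l Gl indexg1 leq_pred orbT.
have G'l : G^`(1)^`(l.+1) = 1 by rewrite der_der1.
have reach' C := IHl G^`(1)%G C G'l.
apply: subset_trans (direct_power_der_step _ _ _ _ genA reach') _.
apply: expgs_leq; first exact: setU11.
apply: leq_trans (der_bound_step n _ #|G| _ n0 _ _ _) _.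
- exact: indexg_gt0.
- by rewrite dvdn_leq // dvdn_indexg.
- rewrite !muln_gt0 expn_gt0 n0 cardG_gt0 /=.
  by rewrite prodn_gt0 // => i; rewrite addn1.
(* The step contributes one factor [n] and the factor [#|G| + 1] at index [0]; its index [#|G : G'|]
   merges with [#|G'|] into [#|G|] by Lagrange. *)
rewrite big_nat_recl //= [(n ^ l.+2)%N]expnS.
under [in X in _ <= X]eq_bigr => i _ do rewrite -der_der1.
have := Lagrange (der_sub 1 G); rewrite /=.
set p := (n ^ _)%N; set q := (\prod_(_ <= _ < _) _)%N; set g := #|G| => <-.
by rewrite leq_eqVlt; apply/orP; left; apply/eqP; ring.
Qed.

End DirectPower.

Theorem corollary5p19 (gT : finGroupType) (G : {group gT}) (l : nat) :
  ~~ abelian G -> solvable G ->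
  G^`(l) = 1 -> (forall k : nat, G^`(k) = 1 -> l <= k) ->
  forall n : nat, 1 <= n ->
    max_diam (direct_power G n) <=
      (n ^ l * #|G| * \prod_(0 <= i < l.-1) (#|G^`(i)| + 1))%N.
Proof.
case: l => [|l] nabG _ Gl _ n n0.
  (* Derived length [0] would make [G] trivial, hence abelian. *)
  by rewrite derg0 in Gl; rewrite Gl abelian1 in nabG.
apply/bigmax_leqP=> A /eqP genA; apply: diam_leq => //.
exact: direct_power_reach.
Qed.
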